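(* Let $n\ge2$, let $G(V,E)$ be a directed graph on $V=\{1,\dots,n\}$ with $m=|E|$ edges and positive weights $\alpha_{ij}$ ($ij\in E$), let $r_i>0$, $\tau>0$, $g^w_{ij}>0$ ($ij\in E$), and assume that $G$ is connected and has a unique leader, $\kappa_1\neq\kappa_2$, $0<p<2$ and $\rho(\hat J_2)<1$. Consider the mean dynamics of the noisy clock synchronization system defined in the context, with stationary noise mean $\bar w=[\bar w_{ij}]_{ij\in E}\in\mathbb R^m$. Then, for every initial condition, the deviations $\delta z_k=[\delta x(t_k)^T\,\delta s(t_k)^T\,\delta y(t_k)^T]^T$ converge as $k\to\infty$ to $\delta z^*=[\delta x^{*T}\,\delta s^{*T}\,\delta y^{*T}]^T$ given by $$\delta x^*=N_1L^\dagger\,\delta w,\qquad \delta s^*=\mathbf 0_n,\qquad \delta y^*=\mathbf 0_n,$$ where $L^\dagger$ is the (Moore--Penrose) pseudo-inverse of $L$ and $\delta w:=-N_2B_G^-\,\mathrm{diag}[\alpha_{ij}g^w_{ij}]\,\bar w$.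
   Context: $G(V,E)$ has no self-loops; $ij\in E$ means node $i$ measures its clock offset with respect to $j$, and $\mathcal N_i=\{j:ij\in E\}$. A leader is a node to whom every other node can reach through a directed path; $G$ is connected if it has at least one leader (equivalently, the Laplacian has $0$ as a simple eigenvalue), and $G$ has a unique leader if it has exactly one. The Laplacian $L\in\mathbb R^{n\times n}$ has $L_{ii}=\sum_{j\in\mathcal N_i}\alpha_{ij}$, $L_{ij}=-\alpha_{ij}$ if $ij\in E$, $0$ otherwise. $R=\mathrm{diag}(r_i)$. $B_G\in\mathbb R^{n\times m}$ is the incidence matrix of $G$: the column of edge $ij$ has entry $-1$ in row $i$, $+1$ in row $j$, and $0$ elsewhere. $B_G^-=\min\{B_G,0\}$ entrywise, so that $L=B_G^-\mathrm{diag}[\alpha_{ij}]B_G^T$; explicitly, the $i$-th entry of $-B_G^-\mathrm{diag}[\alpha_{ij}g^w_{ij}]\bar w$ is $\sum_{j\in\mathcal N_i}\alpha_{ij}g^w_{ij}\bar w_{ij}$. In the noisy system each offset measurement $x_j(t_k)-x_i(t_k)$ is replaced by $x_j(t_k)-x_i(t_k)+g^w_{ij}w_{ij}(t_k)$, where $w_{ij}(t_k)$ is random with stationary mean $\bar w_{ij}$, and the skew update receives an additional zero-mean noise. The mean dynamics, i.e. the evolution of the first moments $x_i(t_k),s_i(t_k),y_i(t_k)$ (same symbols used for the expectations, $t_k=t_0+k\tau$), is $$x_i(t_{k+1})=x_i(t_k)+\tau r_is_i(t_k),$$ $$s_i(t_{k+1})=s_i(t_k)+\kappa_1\sum_{j\in\mathcal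 N_i}\alpha_{ij}\big(x_j(t_k)-x_i(t_k)+g^w_{ij}\bar w_{ij}\big)-\kappa_2y_i(t_k),$$ $$y_i(t_{k+1})=p\sum_{j\in\mathcal N_i}\alpha_{ij}\big(x_j(t_k)-x_i(t_k)+g^w_{ij}\bar w_{ij}\big)+(1-p)y_i(t_k).$$ $\xi$ is the unique left eigenvector of $L$ for the eigenvalue $0$ with $\sum_i\xi_i=1$, and $\frac1\gamma=\sum_i\frac{\xi_i}{r_i}$. Put $N_1=I_n-\gamma\mathbf 1_n\xi^TR^{-1}$ and $N_2=I_n-\gamma R^{-1}\mathbf 1_n\xi^T$. The deviations are $\delta x(t_k)=N_1x(t_k)$, $\delta s(t_k)=N_2s(t_k)$, $\delta y(t_k)=N_2y(t_k)$; that is, $\delta x_i=x_i-\gamma\sum_j\frac{\xi_j}{r_j}x_j$, $\delta s_i=s_i-\frac{\gamma}{r_i}\sum_j\xi_js_j$, $\delta y_i=y_i-\frac{\gamma}{r_i}\sum_j\xi_jy_j$. Let $$A=\begin{bmatrix} I_n&\tau R&0\\-\kappa_1L&I_n&-\kappa_2I_n\\-pL&0&(1-p)I_n\end{bmatrix}.$$ When $G$ is connected, $\kappa_1\ne\kappa_2$, $p>0$, the $3n$ eigenvalues of $A$ (with multiplicity) include $1,1,1-p$, the Jordan form of $A$ is $\mathrm{blockdiag}(\hat J_1,\hat J_2)$ with $\hat J_1=\begin{bmatrix}1&1&0\\0&1&0\\0&0&1-p\end{bmatrix}$, and $\hat J_2$ collects the Jordan blocks of the remaining $3n-3$ eigenvalues.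 $\rho$ denotes spectral radius. *)

(* Defs.v *)
From HB Require Import structures.
From mathcomp Require Import all_boot all_order all_algebra.
From mathcomp Require Import complex.
From mathcomp Require Import all_classical all_reals all_analysis.

Set Implicit Arguments.
Unset Strict Implicit.
Unset Printing Implicit Defensive.

Import Order.TTheory GRing.Theory Num.Theory.
Import numFieldNormedType.Exports.

Local Open Scope classical_set_scope.
Local Open Scope ring_scope.
Local Open Scope complex_scope.

(* A directed graph on 'I_n is its edge set E : {set 'I_n * 'I_n}.  Edge data
   (weights, gains, mean noises) are total functions of the two endpoints; only
   their values on E are ever used. *)

Section Graph.
Variables (n : nat) (E : {set 'I_n * 'I_n}).

Definition no_self_loops : Prop := forall i, (i, i) \notin E.

Definition edge_rel : rel 'I_n := fun i j => (i, j) \in E.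

Definition is_leader (l : 'I_n) : Prop := forall i, connect edge_rel i l.

Definition graph_connected : Prop := exists l, is_leader l.

Definition has_unique_leader : Prop := exists! l, is_leader l.

Variable R : realType.

Definition laplacian (alpha : 'I_n -> 'I_n -> R) : 'M[R]_n :=
  \matrix_(i, j) if i == j then \sum_(k | (i, k) \in E) alpha i k
                 else if (i, j) \in E then - alpha i j else 0.

(* Edges are numbered by the enumeration of the finite set E. *)
Definition edge_vec (f : 'I_n -> 'I_n -> R) : 'cV[R]_#|E| :=
  \col_k f (enum_val k).1 (enum_val k).2.

Definition incidence : 'M[R]_(n, #|E|) :=
  \matrix_(i, k) if i == (enum_val k).1 then -1
                 else if i == (enum_val k).2 then 1 else 0.

Definition incidence_neg : 'M[R]_(n, #|E|) :=
  map_mx (fun b => Num.min b 0) incidence.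

End Graph.

Arguments incidence {n} E R.
Arguments incidence_neg {n} E R.

Section LinearAlgebra.

(* The four Penrose equations; over the reals the adjoint is the transpose. *)
Definition is_pseudo_inverse (R : realType) (m n : nat)
    (M : 'M[R]_(m, n)) (X : 'M[R]_(n, m)) : Prop :=
  [/\ M *m X *m M = M, X *m M *m X = X,
      (M *m X)^T = M *m X & (X *m M)^T = X *m M].

(* The sizes m and k are equal as soon as P and Q exist; keeping them apart
   avoids casts between n + (n + n) and 3 + (3 * n - 3). *)
Definition similar_mx (F : fieldType) (m k : nat)
    (M : 'M[F]_m) (N : 'M[F]_k) : Prop :=
  exists (P : 'M[F]_(m, k)) (Q : 'M[F]_(k, m)),
    [/\ P *m Q = 1%:M, Q *m P = 1%:M & Q *m M *m P = N].

Definition jordan_block (F : fieldType) (d : nat) (a : F) : 'M[F]_d :=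
  \matrix_(i, j) (a *+ (i == j) + (j == i.+1 :> nat)%:R).

Definition is_jordan_matrix (F : fieldType) (d : nat) (J : 'M[F]_d) : Prop :=
  exists (q : nat) (sz : 'I_q -> nat) (ev : 'I_q -> F)
         (e : (\sum_i sz i)%N = d),
    (forall i, (0 < sz i)%N) /\
    J = castmx (e, e) (\mxdiag_i jordan_block (sz i) (ev i)).

(* The supremum is over a finite set, nonempty when 0 < d. *)
Definition spectral_radius (R : realType) (d : nat) (M : 'M[R[i]]_d) : R :=
  sup [set Normc.normc z | z in [set z : R[i] | eigenvalue M z]].

End LinearAlgebra.

Section ClockSync.
Variables (R : realType) (n : nat) (E : {set 'I_n * 'I_n}).
Variables (alpha : 'I_n -> 'I_n -> R) (r : 'I_n -> R).
Local Notation L := (laplacian E alpha).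

Definition rate_mx : 'M[R]_n := diag_mx (\row_i r i).

Definition ones : 'cV[R]_n := const_mx 1.

Definition is_normalized_left_null (xi : 'cV[R]_n) : Prop :=
  xi^T *m L = 0 /\ \sum_i xi i 0 = 1.

Definition gamma (xi : 'cV[R]_n) : R := (\sum_i xi i 0 / r i)^-1.

Definition N1 (xi : 'cV[R]_n) : 'M[R]_n :=
  1%:M - gamma xi *: (ones *m xi^T *m invmx rate_mx).

Definition N2 (xi : 'cV[R]_n) : 'M[R]_n :=
  1%:M - gamma xi *: (invmx rate_mx *m ones *m xi^T).

Variables (tau kappa1 kappa2 p : R).

Definition sync_mx : 'M[R]_(n + (n + n)) :=
  col_mx (row_mx 1%:M (row_mx (tau *: rate_mx) 0))
 (col_mx (row_mx (- kappa1 *: L) (row_mx 1%:M (- kappa2)%:M))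
         (row_mx (- p *: L) (row_mx 0 (1 - p)%:M))).

Definition jordan_J1 : 'M[R[i]]_3 :=
  \matrix_(i, j)
    nth 0 (nth [::] [:: [:: 1; 1; 0]; [:: 0; 1; 0]; [:: 0; 0; (1 - p)%:C]] i) j.

(* J2 collects the Jordan blocks of the 3n - 3 eigenvalues other than those of
   jordan_J1; it is determined up to the order of its blocks. *)
Definition is_hat_J2 (J2 : 'M[R[i]]_(3 * n - 3)) : Prop :=
  is_jordan_matrix J2 /\
  similar_mx (map_mx (real_complex R) sync_mx) (block_mx jordan_J1 0 0 J2).

Variables (g wbar : 'I_n -> 'I_n -> R).

(* x k, s k and y k are the first moments at time t_k = t_0 + k * tau. *)
Definition mean_dynamics (x s y : nat -> 'cV[R]_n) : Prop :=
  let meas k i := \sum_(j | (i, j) \in E)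
    alpha i j * (x k j 0 - x k i 0 + g i j * wbar i j) in
  forall k i,
  [/\ x k.+1 i 0 = x k i 0 + tau * r i * s k i 0,
      s k.+1 i 0 = s k i 0 + kappa1 * meas k i - kappa2 * y k i 0
    & y k.+1 i 0 = p * meas k i + (1 - p) * y k i 0].

Definition delta_w (xi : 'cV[R]_n) : 'cV[R]_n :=
  - (N2 xi *m incidence_neg E R
       *m diag_mx (edge_vec E (fun i j => alpha i j * g i j))^T
       *m edge_vec E wbar).

End ClockSync.

(* Main.v *)
(* The unique leader l is a sink, so the left kernel of the Laplacian L is spanned
   by the basis vector e_l, xi = e_l, and the noise w in the skew updates vanishes
   at l.  Hence w lies in the range of L, delta_w = w, and (Ldag w, 0, 0) is a
   fixed point of the affine mean dynamics: the difference z from it satisfies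
   z_(k+1) = A z_k.  With P = diag(N1, N2, N2) one has P A P = P A, so d_k = P z_k
   is an orbit of P A.  A nonzero eigenvalue of P A is an eigenvalue of A, that is
   1, 1 - p or an eigenvalue of J2; the value 1 is excluded because P kills the
   corresponding left eigenvectors of A, which come from the left kernel of L.
   Thus the spectral radius of P A is below 1, and its orbits tend to 0 by
   Cayley-Hamilton, removing one linear factor of the characteristic polynomial
   at a time. *)
Require Import Defs.
From HB Require Import structures.
From mathcomp Require Import all_boot all_order all_algebra.
From mathcomp Require Import complex.
From mathcomp Require Import ring lra.
From mathcomp Require Import all_classical all_reals all_analysis.

Set Implicit Arguments.
Unset Strict Implicit.
Unset Printing Implicit Defensive.

Import Order.TTheory GRing.Theory Num.Theory.
Import numFieldNormedType.Exports.

Local Open Scope classical_set_scope.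
Local Open Scope ring_scope.
Local Open Scope complex_scope.

(** * Orbits of complex matrices with spectrum in the open unit disc *)

Lemma contraction_cvg0 (R : realType) (q : R) (a e : nat -> R) :
  0 <= q < 1 -> (forall k, 0 <= a k) ->
  (forall k, a k.+1 <= q * a k + e k) ->
  e @ \oo --> 0 -> a @ \oo --> 0.
Proof.
move=> /andP[q0 q1] a0 ha he.
apply/cvgr0Pnorm_le => eps eps0.
(* With this tolerance [eps / 2] is a fixed point of [t -> q * t + (1 - q) * (eps / 2)], so it
   passes through the induction in [bound]; the other half of [eps] absorbs the geometric term. *)
have d0 : 0 < (1 - q) * (eps / 2) by rewrite mulr_gt0 ?divr_gt0 ?subr_gt0.
have [K _ hK] : \forall k \near \oo, `|e k| <= (1 - q) * (eps / 2).
  by move/cvgr0Pnorm_le : he; apply.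
have qn : `|q| < 1 by rewrite ger0_norm.
have [J _ hJ] : \forall j \near \oo, `|geometric (a K) q j| <= eps / 2.
  by move/cvgr0Pnorm_le : (cvg_geometric (a K) qn); apply; rewrite divr_gt0.
have bound j : a (K + j)%N <= a K * q ^+ j + eps / 2.
  elim: j => [|j IH]; first by rewrite addn0 expr0 mulr1 lerDl divr_ge0 // ltW.
  rewrite addnS; apply: le_trans (ha _) _.
  have /(le_trans (ler_norm _)) := hK (K + j)%N (leq_addr _ _).
  have := ler_wpM2l q0 IH.
  rewrite exprS; lra.
exists (K + J)%N => // k /= hk.
have Kk : (K <= k)%N by apply: leq_trans hk; exact: leq_addr.
rewrite ger0_norm // -(subnKC Kk); apply: le_trans (bound _) _.
have /(le_trans (ler_norm _)) : `|geometric (a K) q (k - K)%N| <= eps / 2.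
  by apply: hJ; rewrite /= leq_subRL.
rewrite /geometric /=; lra.
Qed.

(** Since [u k.+1] is [a * u k] plus a vanishing perturbation, the moduli obey the contraction
    recursion with ratio [normc a]. *)
Lemma normc_cvg0_shift (R : realType) (a : R[i]) (u : nat -> R[i]) :
  Normc.normc a < 1 ->
  (fun k => Normc.normc (u k.+1 - a * u k)) @ \oo --> (0 : R) ->
  (fun k => Normc.normc (u k)) @ \oo --> (0 : R).
Proof.
move=> a1; apply: (@contraction_cvg0 _ (Normc.normc a)) => [|k|k].
- by rewrite a1 andbT; case: (a) => b c; exact: sqrtr_ge0.
- by case: (u k) => b c; exact: sqrtr_ge0.
rewrite -Normc.normcM -{1}[u k.+1](addrNK (a * u k)) [leRHS]addrC.
exact: le_normcD.
Qed.

(* Induction on the roots: v k = (M - a) u k is again an orbit of M, annihilated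
   by the remaining factors, so u k.+1 - a u k tends to 0. *)
Lemma orbit_cvg0_of_root_prod (R : realType) (m : nat) (M : 'M[R[i]]_m.+1)
    (rs : seq R[i]) :
  {in rs, forall a, Normc.normc a < 1} ->
  forall u : nat -> 'cV[R[i]]_m.+1,
  (forall k, u k.+1 = M *m u k) ->
  (forall k, horner_mx M (\prod_(a <- rs) ('X - a%:P)) *m u k = 0) ->
  forall i, (fun k => Normc.normc (u k i 0)) @ \oo --> (0 : R).
Proof.
elim: rs => [_ u _ hu i|a rs IH ha u hM hu i].
  under eq_fun => k.
    have := hu k; rewrite big_nil rmorph1 mul1mx => ->.
    rewrite mxE Normc.normc0; over.
  exact: cvg_cst.
apply: (@normc_cvg0_shift _ a) => /=; first by apply: ha; rewrite mem_head.
suff: (fun k => Normc.normc ((u k.+1 - a *: u k) i 0)) @ \oo --> (0 : R).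
  by under eq_fun => k do rewrite !mxE.
apply: IH => [b hb|k|k]; first by apply: ha; rewrite in_cons hb orbT.
  by rewrite mulmxBr -scalemxAr -!hM.
have := hu k; rewrite big_cons mulrC rmorphM rmorphB /= horner_mx_X horner_mx_C.
by rewrite -mulmxA mulmxBl mul_scalar_mx -hM.
Qed.

Lemma orbit_cvg0 (R : realType) (m : nat) (M : 'M[R[i]]_m)
    (u : nat -> 'cV[R[i]]_m) :
  (forall a, eigenvalue M a -> Normc.normc a < 1) ->
  (forall k, u k.+1 = M *m u k) ->
  forall i, (fun k => Normc.normc (u k i 0)) @ \oo --> (0 : R).
Proof.
case: m M u => [|m] M u hM hu i; first by case: i.
have [rs hrs] := closed_field_poly_normal (char_poly M).
have mon := monicP (char_poly_monic M).
rewrite mon scale1r in hrs.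
apply: (@orbit_cvg0_of_root_prod _ _ M rs) => // [a ha|k].
  by apply: hM; rewrite eigenvalue_root_char hrs root_prod_XsubC.
by rewrite -hrs Cayley_Hamilton mul0mx.
Qed.

Lemma eigenvalue_normc_le_spectral_radius (R : realType) (d : nat)
    (M : 'M[R[i]]_d) (a : R[i]) :
  eigenvalue M a -> Normc.normc a <= spectral_radius M.
Proof.
move=> ha; apply: ub_le_sup; last by exists a.
have [rs hrs] := closed_field_poly_normal (char_poly M).
have mon := monicP (char_poly_monic M).
rewrite mon scale1r in hrs.
(* The supremum dominates only if the set is bounded above; the sum of the moduli of all
   characteristic roots is a crude bound. *)
exists (\sum_(z <- rs) Normc.normc z) => _ [z hz <-].
have : z \in rs by rewrite -root_prod_XsubC -hrs -eigenvalue_root_char.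
move=> zrs; rewrite (big_rem z zrs) /= lerDl.
by apply: sumr_ge0 => -[b c] _; exact: sqrtr_ge0.
Qed.

Lemma cvg_cV_entries (R : realType) (m : nat) (u : nat -> 'cV[R]_m) (l : 'cV[R]_m) :
  (forall i, (fun k => u k i 0) @ \oo --> l i 0) -> u @ \oo --> l.
Proof.
move=> h; apply/cvgrPdist_le => eps eps0.
have H : \forall k \near \oo, forall i, `|l i 0 - u k i 0| <= eps.
  apply: filter_forall => i.
  by move/cvgrPdist_le : (h i); apply.
apply: filterS H => k hk.
rewrite /Num.norm /= mx_normrE; apply: bigmax_le => [|[i j] _]; first exact: ltW.
by rewrite !mxE /= (ord1 j).
Qed.

(** * Right and left kernels of the Laplacian *)

Section LaplacianKernel.
Variables (R : realType) (n : nat) (E : {set 'I_n * 'I_n}).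
Variable alpha : 'I_n -> 'I_n -> R.
Hypothesis hE : no_self_loops E.
Hypothesis halpha : forall i j, (i, j) \in E -> 0 < alpha i j.
Local Notation L := (laplacian E alpha).

Lemma laplacian_mulE (x : 'cV[R]_n) i :
  (L *m x) i 0 = \sum_(j | (i, j) \in E) alpha i j * (x i 0 - x j 0).
Proof.
rewrite mxE (bigD1 i) //= mxE eqxx mulr_suml.
under [in RHS]eq_bigr do rewrite mulrBr.
rewrite sumrB; congr (_ + _).
rewrite -sumrN big_mkcond [in RHS]big_mkcond; apply: eq_bigr => j _.
rewrite mxE; have [->|ji] := eqVneq j i; first by rewrite (negbTE (hE i)).
by rewrite /=; case: ifP; rewrite ?mulNr ?mul0r.
Qed.

Lemma laplacian_ones : L *m ones R n = 0.
Proof.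
apply/matrixP => i j; rewrite ord1 laplacian_mulE [RHS]mxE big1 // => k _.
by rewrite !mxE subrr mulr0.
Qed.

(* Maximum principle: at a maximal entry all out-neighbours are maximal too, and
   a path leads from there to the leader. *)
Lemma laplacian_null_le_leader (l : 'I_n) (x : 'cV[R]_n) :
  is_leader E l -> L *m x = 0 -> forall i, x i 0 <= x l 0.
Proof.
move=> hl hx i.
have [i0 _ hi0] := @Order.TotalTheory.arg_maxP _ _ _ i predT (fun i => x i 0) isT.
suff -> : x l 0 = x i0 0 by exact: hi0.
have /connectP[pth hp ->] := hl i0.
suff gen k : path (edge_rel E) k pth -> x k 0 = x i0 0 -> x (last k pth) 0 = x i0 0.
  exact: gen.
elim: pth k {hp} => [|j pth IH] //= k /andP[kj hp] xk.
apply: IH hp _; rewrite -xk; apply/eqP; rewrite eq_sym -subr_eq0.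
have h : (L *m x) k 0 = 0 by rewrite hx mxE.
rewrite laplacian_mulE in h.
have pos v : (k, v) \in E -> 0 <= alpha k v * (x k 0 - x v 0).
  by move=> kv; rewrite mulr_ge0 ?(ltW (halpha kv)) // subr_ge0 xk; exact: hi0.
have /allP := etrans (esym (psumr_eq0 _ pos)) (introT eqP h).
move=> /(_ j (mem_index_enum _)) /implyP /(_ kj).
by rewrite mulf_eq0 gt_eqF ?halpha.
Qed.

(** The maximum principle for [- x] is a minimum principle for [x]. *)
Lemma laplacian_null_const (l : 'I_n) (x : 'cV[R]_n) :
  is_leader E l -> L *m x = 0 -> forall i, x i 0 = x l 0.
Proof.
move=> hl hx i; apply/eqP; rewrite eq_le laplacian_null_le_leader //=.
have := @laplacian_null_le_leader l (- x) hl _ i; rewrite !mxE lerN2; apply.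
by rewrite mulmxN hx oppr0.
Qed.

(** The head of an edge leaving [l] is reached by every node through [l], hence is a leader too;
    uniqueness turns the edge into a self-loop. *)
Lemma unique_leader_sink (l : 'I_n) :
  is_leader E l -> (forall l', is_leader E l' -> l = l') ->
  forall j, (l, j) \notin E.
Proof.
move=> hl ul j; apply/negP => lj.
have jl : l = j.
  by apply: ul => i; apply: connect_trans (hl i) _; exact: connect1.
by move: lj; rewrite -jl (negbTE (hE l)).
Qed.

(** Right null vectors are constant, and a square matrix and its transpose have kernels of equal
    dimension, so the left kernel is at most a line. Row [l] of the Laplacian is zero since [l] is a
    sink, so the basis vector at [l] spans that line. *)
Lemma laplacian_left_null (l : 'I_n) (b : 'rV[R]_n) :
  is_leader E l -> (forall j, (l, j) \notin E) ->
  b *m L = 0 -> b = b 0 l *: delta_mx 0 l.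
Proof.
move=> hl sink hb.
have rk1 : (\rank (kermx L^T) <= 1)%N.
  apply: leq_trans (rank_leq_row (const_mx 1 : 'rV[R]_n)).
  apply: mxrankS; apply/row_subP => i; set v := row i _.
  have /sub_kermxP hv : (v <= kermx L^T)%MS by exact: row_sub.
  have hLv : L *m v^T = 0 by rewrite -[L]trmxK -trmx_mul hv trmx0.
  apply/sub_rVP; exists (v 0 l); apply/rowP => j.
  by have := laplacian_null_const hl hLv j; rewrite !mxE mulr1.
have rk2 : (\rank (kermx L) <= 1)%N by move: rk1; rewrite !mxrank_ker mxrank_tr.
have dl : (delta_mx 0 l : 'rV[R]_n) *m L = 0.
  rewrite -rowE; apply/rowP => j; rewrite !mxE big_pred0 => [|k]; last exact/negbTE.
  by rewrite (negbTE (sink j)); case: ifP.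
have /sub_kermxP bk := hb.
have /sub_kermxP dk := dl.
have [le eqv] := mxrank_leqif_sup dk.
have : (kermx L <= (delta_mx 0 l : 'rV[R]_n))%MS.
  by rewrite -eqv eqn_leq le mxrank_delta.
move=> /(submx_trans bk)/sub_rVP[c ->].
by rewrite !mxE !eqxx mulr1.
Qed.

Lemma normalized_left_null_unique_leader (l : 'I_n) (xi : 'cV[R]_n) :
  is_leader E l -> (forall j, (l, j) \notin E) ->
  is_normalized_left_null E alpha xi -> xi = delta_mx l 0.
Proof.
move=> hl sink [hxi hsum].
have := congr1 trmx (laplacian_left_null hl sink hxi).
rewrite trmxK linearZ /= trmx_delta mxE => hx.
move: hsum; rewrite hx (bigD1 l) //= big1 => [|i il].
  by rewrite !mxE !eqxx !mulr1 addr0 => ->; rewrite scale1r.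
by rewrite !mxE (negbTE il) mulr0.
Qed.

(* The rows of 1 - L *m Ldag are left null vectors of L, hence multiples of the
   l-th basis vector. *)
Lemma laplacian_pseudo_inverseK (l : 'I_n) (Ldag : 'M[R]_n) (w : 'cV[R]_n) :
  is_leader E l -> (forall j, (l, j) \notin E) ->
  is_pseudo_inverse L Ldag -> w l 0 = 0 -> L *m (Ldag *m w) = w.
Proof.
move=> hl sink [hL _ _ _] hw.
apply/eqP; rewrite mulmxA -subr_eq0 -{2}[w]mul1mx -mulmxBl; apply/eqP/row_matrixP => i.
rewrite row_mul row0 (laplacian_left_null hl sink (b := row i _)).
  by rewrite -scalemxAl -rowE; apply/matrixP => a b; rewrite !mxE ord1 hw mulr0.
by rewrite -row_mul mulmxBl mul1mx hL subrr row0.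
Qed.

End LaplacianKernel.

(** * Eigenvalues under similarity, block sums and compression *)

Section EigenvalueTransfer.
Variable F : fieldType.

Lemma eigenvalue_similar (m k : nat) (M : 'M[F]_m) (N : 'M[F]_k) (a : F) :
  similar_mx M N -> eigenvalue M a -> eigenvalue N a.
Proof.
move=> [P [Q [PQ _ <-]]] /eigenvalueP[v vM v0].
apply/eigenvalueP; exists (v *m P).
  by rewrite !mulmxA -(mulmxA v) PQ mulmx1 vM scalemxAl.
apply: contraNneq v0 => vP; by rewrite -[v]mulmx1 -PQ mulmxA vP mul0mx.
Qed.

Lemma eigenvalue_block_diag (m k : nat) (M : 'M[F]_m) (N : 'M[F]_k) (a : F) :
  eigenvalue (block_mx M 0 0 N) a -> eigenvalue M a \/ eigenvalue N a.
Proof.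
case/eigenvalueP => v; rewrite -[v]hsubmxK mul_row_block !mulmx0 addr0 add0r.
rewrite scale_row_mx => /eq_row_mx[hl hr] v0.
have [l0|l0] := eqVneq (lsubmx v) 0; last by left; apply/eigenvalueP; exists (lsubmx v).
right; apply/eigenvalueP; exists (rsubmx v) => //.
by apply: contraNneq v0 => r0; rewrite l0 r0 row_mx0.
Qed.

(** Multiplying [v P M = a v] by [P] on the right does not change its left side, so [a v P = a v],
    and the nonzero [a] cancels. *)
Lemma compression_eigenvector (m : nat) (P M : 'M[F]_m) (a : F) (v : 'rV[F]_m) :
  P *m M *m P = P *m M -> a != 0 -> v *m (P *m M) = a *: v ->
  v *m P = v /\ v *m M = a *: v.
Proof.
move=> PMP a0 hv.
have vP : v *m P = v.
  apply: (scalerI a0); rewrite scalemxAl -hv -!mulmxA [P *m (M *m P)]mulmxA.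
  by rewrite PMP.
by split => //; rewrite -{1}vP -mulmxA.
Qed.

End EigenvalueTransfer.

Lemma normc_real (R : realType) (a : R) : Normc.normc (real_complex R a) = `|a|.
Proof. by rewrite /= expr0n addr0 sqrtr_sqr. Qed.

(** If [a != 1], the first two columns of the eigenvector equation force the first two entries of
    [v] to vanish; the third is then nonzero and gives [a]. *)
Lemma jordan_J1_eigenvalue (R : realType) (p : R) (a : R[i]) :
  eigenvalue (jordan_J1 p) a -> a = 1 \/ a = (1 - p)%:C.
Proof.
case/eigenvalueP => v hv v0.
have [->|a1] := eqVneq a 1; [by left | right].
have e0 : v 0 0 = a * v 0 0.
  have := congr1 (fun u : 'rV__ => u 0 0) hv.
  by rewrite !mxE !big_ord_recl big_ord0 !mxE /= !mulr0 mulr1 !addr0.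
have e1 : v 0 0 + v 0 1 = a * v 0 1.
  have := congr1 (fun u : 'rV__ => u 0 1) hv.
  rewrite !mxE !big_ord_recl big_ord0 !mxE /= !mulr0 !mulr1 !addr0.
  by rewrite (_ : lift _ _ = 1) //; exact: val_inj.
have e2 : v 0 ord_max * (1 - p)%:C = a * v 0 ord_max.
  have := congr1 (fun u : 'rV__ => u 0 ord_max) hv.
  rewrite !mxE !big_ord_recl big_ord0 !mxE /= !mulr0 !addr0 !add0r.
  by rewrite (_ : lift _ (lift _ _) = ord_max) //; exact: val_inj.
have aux z : z = a * z -> z = 0.
  move=> hz; apply/eqP; have /eqP : (1 - a) * z = 0 by rewrite mulrBl mul1r -hz subrr.
  by rewrite mulf_eq0 subr_eq0 eq_sym (negbTE a1).
have v00 := aux _ e0.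
have v01 : v 0 1 = 0 by apply: aux; rewrite -e1 v00 add0r.
have v02 : v 0 ord_max != 0.
  apply: contraNneq v0 => v02; apply/eqP/rowP => i; rewrite mxE.
  case: i => [[|[|[|i]]] hi] //.
  - by rewrite -[RHS]v00; congr (v 0 _); exact: val_inj.
  - by rewrite -[RHS]v01; congr (v 0 _); exact: val_inj.
  - by rewrite -[RHS]v02; congr (v 0 _); exact: val_inj.
by apply: (mulIf v02); rewrite -e2 mulrC.
Qed.

(** * Spectrum of the dynamics projected onto the deviations *)

Section DeviationSpectrum.
Variables (R : realType) (n : nat) (E : {set 'I_n * 'I_n}).
Variables (alpha : 'I_n -> 'I_n -> R) (r : 'I_n -> R) (xi : 'cV[R]_n).
Hypothesis hr : forall i, 0 < r i.
Hypothesis hxi : \sum_i xi i 0 / r i != 0.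
Local Notation L := (laplacian E alpha).
Local Notation D := (rate_mx r).

Lemma rate_mx_unit : D \in unitmx.
Proof.
rewrite unitmxE det_diag unitfE; apply/prodf_neq0 => i _.
by rewrite mxE gt_eqF.
Qed.

Lemma invmx_rate_mx : invmx D = diag_mx (\row_i (r i)^-1).
Proof.
apply: (can_inj (mulKmx rate_mx_unit)); rewrite mulmxV ?rate_mx_unit //.
apply/matrixP => i j; rewrite mul_diag_mx !mxE.
have [->|ij] := eqVneq i j; last by rewrite !mulr0n mulr0.
by rewrite !mulr1n divff // gt_eqF.
Qed.

(** This normalisation makes the rank-one terms in [N1] and [N2] idempotent, so both matrices are
    projections. *)
Lemma gammaE : gamma r xi *: (xi^T *m invmx D *m ones R n) = 1%:M.
Proof.
apply/matrixP => i j; rewrite !ord1 invmx_rate_mx !mxE /gamma.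
rewrite -[RHS](mulVf hxi); congr (_ * _); apply: eq_bigr => k _.
by rewrite mul_mx_diag !mxE mulr1.
Qed.

Lemma N1_ones : N1 r xi *m ones R n = 0.
Proof.
rewrite /N1 mulmxBl mul1mx -scalemxAl -!mulmxA scalemxAr (mulmxA xi^T).
by rewrite gammaE mulmx1 subrr.
Qed.

Lemma N2_ones : N2 r xi *m (invmx D *m ones R n) = 0.
Proof.
rewrite /N2 mulmxBl mul1mx -scalemxAl -(mulmxA _ xi^T) scalemxAr (mulmxA xi^T).
by rewrite gammaE mulmx1 subrr.
Qed.

Lemma xi_N2 : xi^T *m N2 r xi = 0.
Proof.
by rewrite /N2 mulmxBr mulmx1 -scalemxAr !mulmxA scalemxAl gammaE mul1mx subrr.
Qed.

(** The projection onto deviations; its kernel, the synchronised states, is spanned by [ones] in the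
    first block and [invmx D *m ones] in each of the others. *)
Definition deviation_mx : 'M[R]_(n + (n + n)) :=
  block_mx (N1 r xi) 0 0 (block_mx (N2 r xi) 0 0 (N2 r xi)).

Lemma N1_absorb (m : nat) (M : 'M[R]_(m, n)) : M *m ones R n = 0 -> M *m N1 r xi = M.
Proof.
by move=> h; rewrite /N1 mulmxBr mulmx1 -scalemxAr !mulmxA h !mul0mx scaler0 subr0.
Qed.

Lemma N2_absorb (m : nat) (M : 'M[R]_(m, n)) :
  M *m (invmx D *m ones R n) = 0 -> M *m N2 r xi = M.
Proof.
move=> h; rewrite /N2 mulmxBr mulmx1 -scalemxAr -!mulmxA.
by rewrite (mulmxA _ (ones R n)) (mulmxA M) h mul0mx scaler0 subr0.
Qed.

Variables (tau kappa1 kappa2 p : R).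
Local Notation A := (sync_mx E alpha r tau kappa1 kappa2 p).
Hypothesis L_ones : L *m ones R n = 0.

(** The identity says that [A] preserves the kernel of the projection, i.e. synchronised states stay
    synchronised. *)
Lemma deviation_sync_deviation :
  deviation_mx *m A *m deviation_mx = deviation_mx *m A.
Proof.
have h1 := N1_absorb N1_ones.
have hL : L *m N1 r xi = L := N1_absorb L_ones.
have h2 := N2_absorb N2_ones.
(* [D] sends [invmx D *m ones] to [ones], which [N1] kills. *)
have h12 : N1 r xi *m D *m N2 r xi = N1 r xi *m D.
  by apply: N2_absorb; rewrite mulmxA mulmxK ?rate_mx_unit // N1_ones.
rewrite /deviation_mx /sync_mx !mul_block_col !mul0mx ?addr0 ?add0r.
rewrite !mul_col_mx -!mulmxA !mul_row_block !mulmx0 !mul0mx !addr0 !add0r.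
rewrite !mul1mx !mul_scalar_mx !mul_mx_row -!scalemxAl hL !mulmx0 -!scalemxAr.
by rewrite h1 h2 (mulmxA (N1 r xi) D) h12 !mulmx1 !mul_mx_scalar.
Qed.

Hypothesis L_left_null : forall b : 'rV[R]_n, b *m L = 0 -> exists c, b = c *: xi^T.
Hypothesis tau_gt0 : 0 < tau.
Hypothesis kappa_neq : kappa1 <> kappa2.
Hypothesis p_bounds : 0 < p < 2.

(** By compression, a left eigenvector [v = (a, b, c)] for 1 is fixed by both the projection and
    [A]; comparing blocks gives [a = 0], then [b = 0], then [c = 0]. *)
Lemma deviation_sync_no_eigenvalue1 : ~~ eigenvalue (deviation_mx *m A) 1.
Proof.
apply/eigenvalueP => -[v hv]; apply/negP; rewrite negbK.
have [] := compression_eigenvector deviation_sync_deviation (oner_neq0 _) hv.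
rewrite scale1r -[v]hsubmxK -[rsubmx v]hsubmxK.
set a := lsubmx v; set b := lsubmx _; set c := rsubmx (rsubmx v).
rewrite /deviation_mx /sync_mx mul_row_block mulmx0 addr0.
case/eq_row_mx => _; rewrite mulmx0 add0r mul_row_block mulmx0 addr0.
case/eq_row_mx => hb _.
rewrite !mul_row_col !mul_mx_row !mulmx0 !mulmx1 !add_row_mx.
case/eq_row_mx => ha /eq_row_mx[hab hc].
have p0 : p != 0 by case/andP: p_bounds => /gt_eqF ->.
move: hc; rewrite add0r !mul_mx_scalar => hc.
have a0 : a = 0.
  have : a *m (tau *: D) = 0 by apply/eqP; rewrite -(inj_eq (addIr b)) add0r -{1}[b]addr0 hab.
  rewrite -scalemxAr => /eqP; rewrite scaler_eq0 gt_eqF //= => /eqP aD.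
  by rewrite -[a](mulmxK rate_mx_unit) aD mul0mx.
have pc : p *: c = - kappa2 *: b.
  by move: hc => /eqP; rewrite scalerBl scale1r addrCA addrC -subr_eq0 addrK
     subr_eq0 => /eqP.
(* Substituting [p c = - kappa2 b] in the first block column leaves [(kappa2 - kappa1) b L = 0]. *)
have bL : b *m L = 0.
  move: ha; rewrite a0 add0r -!scalemxAr !scalemxAl !scaleNr pc scaleNr opprK.
  rewrite addrC -mulmxDl -scaleNr -scalerDl -scalemxAl => /eqP.
  by rewrite scaler_eq0 subr_eq0 eq_sym => /orP[/eqP|/eqP].
(* [b] is a multiple of [xi^T], which [N2] kills, yet [b] is fixed by [N2]. *)
have b0 : b = 0.
  by rewrite -hb; have [k ->] := L_left_null bL; rewrite -scalemxAl xi_N2 scaler0.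
move: pc; rewrite b0 scaler0 => /eqP; rewrite scaler_eq0 (negbTE p0) => /eqP ->.
by rewrite a0 !row_mx0.
Qed.

Lemma deviation_sync_eigenvalue (J2 : 'M[R[i]]_(3 * n - 3)) (a : R[i]) :
  is_hat_J2 E alpha r tau kappa1 kappa2 p J2 -> spectral_radius J2 < 1 ->
  eigenvalue (map_mx (real_complex R) (deviation_mx *m A)) a -> Normc.normc a < 1.
Proof.
move=> [_ simJ] rho ha.
have [->|a0] := eqVneq a 0; first by rewrite Normc.normc0.
have a1 : a != 1.
  apply: contraNneq deviation_sync_no_eigenvalue1 => a1.
  by rewrite -(eigenvalue_map (real_complex R)) rmorph1 -a1.
have : eigenvalue (map_mx (real_complex R) A) a.
  move: ha => /eigenvalueP[v hv v0]; apply/eigenvalueP; exists v => //.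
  rewrite map_mxM in hv.
  apply: (compression_eigenvector _ a0 hv).2.
  by rewrite -!map_mxM deviation_sync_deviation.
move=> /(eigenvalue_similar simJ)/eigenvalue_block_diag[|].
  case/jordan_J1_eigenvalue => [/eqP|->]; first by rewrite (negbTE a1).
  (* The eigenvalue [1 - p] has modulus below 1 exactly because [0 < p < 2]. *)
  by rewrite normc_real; case/andP: p_bounds => p0 p2; rewrite ltr_norml; lra.
by move=> /eigenvalue_normc_le_spectral_radius /le_lt_trans; apply.
Qed.

End DeviationSpectrum.

(** * Matrix form of the noise and of the mean dynamics *)

Section MeanDynamics.
Variables (R : realType) (n : nat) (E : {set 'I_n * 'I_n}).
Variables (alpha : 'I_n -> 'I_n -> R) (r : 'I_n -> R) (tau kappa1 kappa2 p : R).
Variables (g wbar : 'I_n -> 'I_n -> R).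
Hypothesis hE : no_self_loops E.
Local Notation L := (laplacian E alpha).

Definition mean_offset_noise : 'cV[R]_n :=
  \col_i \sum_(j | (i, j) \in E) alpha i j * g i j * wbar i j.

(** The negative part of an incidence column keeps only the -1 at the tail, so row [i] sums over the
    edges leaving [i], and the sign in [delta_w] cancels this -1. *)
Lemma delta_wE (xi : 'cV[R]_n) :
  delta_w E alpha r g wbar xi = N2 r xi *m mean_offset_noise.
Proof.
rewrite /delta_w -!mulmxA -mulmxN; congr (_ *m _).
apply/matrixP => i j; rewrite !mxE -sumrN.
under eq_bigr => k _ do
  rewrite mul_diag_mx !mxE -mulNr.
(* The contribution of edge [e] to entry [i], as a function of the pair, so that the sum over edge
   numbers becomes a double sum over nodes. *)
pose F (e : 'I_n * 'I_n) : R :=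
  - Num.min (if i == e.1 then -1 else if i == e.2 then 1 else 0) 0
  * (alpha e.1 e.2 * g e.1 e.2 * wbar e.1 e.2).
rewrite -(big_enum_val (A := [in E]) F) big_mkcond /=.
transitivity (\sum_a \sum_b if (a, b) \in E then F (a, b) else 0).
  by rewrite pair_bigA; apply: eq_bigr => -[a b].
rewrite (bigD1 i) //= [X in _ + X]big1 ?addr0 => [|a ai].
  rewrite [RHS]big_mkcond; apply: eq_bigr => b _; case: ifP => // _.
  by rewrite /F /= eqxx min_l ?lerN10 // opprK mul1r.
apply: big1 => b _; case: ifP => // _; rewrite /F /= eq_sym (negbTE ai) min_r ?oppr0 ?mul0r //.
by case: ifP.
Qed.

Lemma mean_dynamicsE (x s y : nat -> 'cV[R]_n) :
  mean_dynamics E alpha r tau kappa1 kappa2 p g wbar x s y ->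
  forall k,
  [/\ x k.+1 = x k + tau *: (rate_mx r *m s k),
      s k.+1 = s k + kappa1 *: (mean_offset_noise - L *m x k) - kappa2 *: y k
    & y k.+1 = p *: (mean_offset_noise - L *m x k) + (1 - p) *: y k].
Proof.
move=> h k.
have meas i : \sum_(j | (i, j) \in E) alpha i j *
    (x k j 0 - x k i 0 + g i j * wbar i j) = (mean_offset_noise - L *m x k) i 0.
  transitivity (mean_offset_noise i 0 - (L *m x k) i 0); last by rewrite !mxE.
  by rewrite laplacian_mulE // mxE -sumrB; apply: eq_bigr => j _; ring.
move: (mean_offset_noise - L *m x k) meas => m meas.
split; apply/matrixP => i j; rewrite ord1; case: (h k i); rewrite meas => hx hs hy.
- by rewrite hx mul_diag_mx !mxE mulrA.
- by rewrite hs !mxE.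
- by rewrite hy !mxE.
Qed.

End MeanDynamics.

(** * Convergence of the deviations *)

Theorem theorem4 (R : realType) (n : nat) (hn : (2 <= n)%N)
  (E : {set 'I_n * 'I_n}) (hE : no_self_loops E)
  (alpha : 'I_n -> 'I_n -> R) (halpha : forall i j, (i, j) \in E -> 0 < alpha i j)
  (r : 'I_n -> R) (hr : forall i, 0 < r i)
  (tau : R) (htau : 0 < tau)
  (g : 'I_n -> 'I_n -> R) (hg : forall i j, (i, j) \in E -> 0 < g i j)
  (hconn : graph_connected E) (hlead : has_unique_leader E)
  (kappa1 kappa2 p : R) (hkappa : kappa1 <> kappa2) (hp : 0 < p < 2)
  (J2 : 'M[R[i]]_(3 * n - 3))
  (hJ2 : is_hat_J2 E alpha r tau kappa1 kappa2 p J2)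
  (hrho : spectral_radius J2 < 1)
  (xi : 'cV[R]_n) (hxi : is_normalized_left_null E alpha xi)
  (Ldag : 'M[R]_n) (hLdag : is_pseudo_inverse (laplacian E alpha) Ldag)
  (wbar : 'I_n -> 'I_n -> R)
  (x s y : nat -> 'cV[R]_n)
  (hdyn : mean_dynamics E alpha r tau kappa1 kappa2 p g wbar x s y) :
  col_mx (N1 r xi *m x k) (col_mx (N2 r xi *m s k) (N2 r xi *m y k))
    @[k --> \oo] -->
  col_mx (N1 r xi *m Ldag *m delta_w E alpha r g wbar xi)
         (col_mx (0 : 'cV[R]_n) (0 : 'cV[R]_n)).
Proof.
have [l [hl ul]] := hlead.
have sink := unique_leader_sink hE hl ul.
have xiE := normalized_left_null_unique_leader hE halpha hl sink hxi.
have hsum : \sum_i xi i 0 / r i != 0.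
  rewrite (bigD1 l) //= big1 => [|i il]; last by rewrite xiE mxE (negbTE il) mul0r.
  by rewrite xiE mxE !eqxx mul1r addr0 invr_eq0 gt_eqF.
have L1 := laplacian_ones alpha hE.
have Lleft (b : 'rV[R]_n) : b *m laplacian E alpha = 0 -> exists c, b = c *: xi^T.
  move=> /(laplacian_left_null hE halpha hl sink) ->.
  by exists (b 0 l); rewrite xiE trmx_delta.
set w := mean_offset_noise E alpha g wbar.
have wl : w l 0 = 0 by rewrite mxE big_pred0 // => j; exact/negbTE.
have Lw : laplacian E alpha *m (Ldag *m w) = w.
  exact: (laplacian_pseudo_inverseK hE halpha hl sink hLdag wl).
(* [N2] fixes [w] because [xi^T *m w] is the entry of [w] at [l], which is 0. *)
have dw : delta_w E alpha r g wbar xi = w.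
  rewrite delta_wE -/w /N2 mulmxBl mul1mx -scalemxAl -!mulmxA.
  rewrite xiE trmx_delta -rowE (_ : row l w = 0) ?mulmx0 ?scaler0 ?subr0 //.
  by apply/matrixP => i j; rewrite !ord1 mxE wl mxE.
set P := deviation_mx r xi; set A := sync_mx E alpha r tau kappa1 kappa2 p.
pose z k := col_mx (x k - Ldag *m w) (col_mx (s k) (y k)).
have zA k : z k.+1 = A *m z k.
  have [hx hs hy] := mean_dynamicsE hE hdyn k.
  rewrite /z hx hs hy /A /sync_mx !mul_col_mx !mul_row_col !mul0mx.
  rewrite !mul1mx !addr0 !add0r !mul_scalar_mx -!scalemxAl !mulmxBr Lw -/w.
  move: (laplacian E alpha *m x k) (rate_mx r *m s k) w {z wl Lw dw} => Lx Rs v.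
  congr (col_mx _ (col_mx _ _)); apply/matrixP => i j; rewrite !mxE; ring.
have uM k : P *m z k.+1 = (P *m A) *m (P *m z k).
  by rewrite zA !mulmxA deviation_sync_deviation.
have conv i : (fun k => (P *m z k) i 0) @ \oo --> (0 : R).
  (* The spectral bound concerns complex eigenvalues, so the real orbit is embedded in [R[i]]; on
     real entries the complex modulus is the absolute value. *)
  pose u k := map_mx (real_complex R) (P *m z k).
  have uC k : u k.+1 = map_mx (real_complex R) (P *m A) *m u k.
    by rewrite /u uM map_mxM.
  have hu := orbit_cvg0 (fun a ha => deviation_sync_eigenvalue hr hsum L1 Lleft
    htau hkappa hp hJ2 hrho ha) uC i.
  apply/norm_cvg0P; move: hu; apply: cvg_trans; apply: near_eq_cvg.
  by apply: nearW => k; rewrite /u mxE normc_real.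
apply: cvg_cV_entries => i.
set lim := col_mx _ _.
(* [lim] is the projection of the fixed point [(Ldag w, 0, 0)], which was subtracted in [z]. *)
have dev k : col_mx (N1 r xi *m x k) (col_mx (N2 r xi *m s k) (N2 r xi *m y k))
    = P *m z k + lim.
  rewrite /lim dw /P /deviation_mx /z !mul_block_col !mul0mx !addr0 !add0r.
  by rewrite !add_col_mx !addr0 mulmxBr mulmxA subrK.
rewrite -[lim i 0]add0r; under eq_fun => k do rewrite dev mxE.
by apply: cvgD; [exact: conv | exact: cvg_cst].
Qed.
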